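(* Let $\zeta\ge1$, let $X_1,\dots,X_{\zeta+1}$ be operators decomposed as $$X_p=\int_{\lambda_p\in\sigma(X_p)}\lambda_p\,dE_{X_p}(\lambda_p)+\int_{\lambda_p\in\sigma(X_p)}(X_p-\lambda_pI)\,dE_{X_p}(\lambda_p),\qquad p=1,\dots,\zeta+1,$$ let $Y_1,\dots,Y_\zeta$ be operators, and let $f,\beta_1,\dots,\beta_\zeta$ be functions of $\zeta+1$ variables for which the GMOIs $T_f^{X_1,\dots,X_{\zeta+1}}$ and $T_{\beta_i}^{X_1,\dots,X_{\zeta+1}}(Y_1,\dots,Y_\zeta)$, $i=1,\dots,\zeta$, are defined. Write $[X]_1^{\zeta+1}$ for the array $X_1,\dots,X_{\zeta+1}$ and $[Y]_1^\zeta$ for the array $Y_1,\dots,Y_\zeta$. Then $$T_{f\prod_{i=1}^{\zeta}\beta_i}^{X_1,[X]_1^{\zeta+1},X_2,[X]_1^{\zeta+1},\ldots,[X]_1^{\zeta+1},X_{\zeta+1}}\big(\underbrace{I,[Y]_1^\zeta,I,\ \ldots,\ I,[Y]_1^\zeta,I}_{\zeta\text{ blocks }I,[Y]_1^\zeta,I}\big) =T_{f}^{X_1,\ldots,X_{\zeta+1}}\Big(T_{\beta_1}^{X_1,\ldots,X_{\zeta+1}}(Y_1,\ldots,Y_{\zeta}),\ldots,T_{\beta_\zeta}^{X_1,\ldots,X_{\zeta+1}}(Y_1,\ldots,Y_{\zeta})\Big).$$ The GMOI on the left has $(\zeta+1)^2$ parameter operators. Here $f\prod_{i}\beta_i$ is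 the function of $(\zeta+1)^2$ variables in which $f$ is evaluated at the variables belonging to the separately listed parameters $X_1,X_2,\dots,X_{\zeta+1}$, and $\beta_i$ is evaluated at the variables belonging to the $i$-th block $[X]_1^{\zeta+1}$ (the one between the separately listed $X_i$ and $X_{i+1}$).
   Context: Operators act on a Hilbert space; $I$ is the identity. $E_X$ denotes the spectral measure of $X$, with $\int_{\sigma(X)}dE_X(\lambda)=I$; operators need not be normal or self-adjoint. For each $\lambda\in\sigma(X)$, $(X-\lambda I)dE_X(\lambda)$ is nilpotent of order $m_\lambda$: $(X-\lambda I)^{\ell}dE_X(\lambda)=0$ for $\ell\ge m_\lambda$. GMOI (generalized multiple operator integral), for any number $n+1$ of parameter operators: for a (sufficiently differentiable) function $\beta$ of $n+1$ variables, put $Y_{n+1}:=I$ and define $$T_\beta^{X_1,\dots,X_{n+1}}(Y_1,\dots,Y_n):=\int_{\sigma(X_1)}\cdots\int_{\sigma(X_{n+1})}\ \sum_{K\subseteq\{1,\dots,n+1\}}\ \sum_{\substack{1\le q_k\le m_{\lambda_k}-1\\ k\in K}}\frac{\big(\prod_{k\in K}\partial_{\lambda_k}^{q_k}\big)\beta(\lambda_1,\dots,\lambda_{n+1})}{\prod_{k\in K}q_k!}\ Z_1Y_1Z_2Y_2\cdots Z_{n+1}Y_{n+1},$$ where $Z_p=(X_p-\lambda_pI)^{q_p}dE_{X_p}(\lambda_p)$ if $p\in K$ and $Z_p=dE_{X_p}(\lambda_p)$ if $p\notin K$. *)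

(* Defs.v *)
From HB Require Import structures.
From mathcomp Require Import all_boot all_order all_algebra complex.
From mathcomp Require Import boolp classical_sets functions reals topology.
From mathcomp Require Import normedtype derive measurable_structure.

Set Implicit Arguments.
Unset Strict Implicit.
Unset Printing Implicit Defensive.

Import Order.TTheory GRing.Theory Num.Theory.
Import numFieldNormedType.Exports.

Local Open Scope complex_scope.
Local Open Scope ring_scope.
Local Open Scope classical_set_scope.

Section Operators.
Variables (R : realType) (H : completeNormedModType R[i]).
Local Notation C := R[i].

(* The completeness of H is part of its type. *)
Definition hilbert_norm (dot : {dot H for Num.conj}) : Prop :=
  forall x : H, `|x| ^+ 2 = dot x x.

Definition bounded_op (T : H -> H) : Prop := linear T /\ continuous T.

Definition sub_scalar (T : H -> H) (z : C) : H -> H := fun h => T h - z *: h.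

Definition spectrum (T : H -> H) : set C :=
  [set z | ~ exists S : H -> H, [/\ bounded_op S,
     cancel (sub_scalar T z) S & cancel S (sub_scalar T z)]].

(* The norm topology of C, used here and for the complex derivatives below, is *)
(* carried by the alias C^o of C.                                              *)
Definition borel : set (set C) := <<s [set U : set C^o | open U] >>.

Record tagged_partition (D : set C) := TaggedPartition {
  tp_size : nat;
  tp_cell : 'I_tp_size -> set C;
  tp_tag : 'I_tp_size -> C;
  tp_borel : forall i, borel (tp_cell i);
  tp_disjoint : trivIset setT tp_cell;
  tp_cover : \bigcup_i tp_cell i = D;
  tp_tagP : forall i, tp_cell i (tp_tag i) }.

Definition refines (D : set C) (P Q : tagged_partition D) : Prop :=
  forall i, exists j, tp_cell (t := P) i `<=` tp_cell (t := Q) j.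

Definition refinement_filter (D : set C) : set_system (tagged_partition D) :=
  filter_from setT (fun Q => [set P | refines P Q]).

Definition riemann_sum (D : set C) (F : C -> set C -> H -> H)
    (h : H) (P : tagged_partition D) : H :=
  \sum_(i < tp_size P) F (tp_tag i) (tp_cell i) h.

(* "The integral over D of F(lambda, dlambda) exists and equals L": the        *)
(* Riemann sums over finite tagged Borel partitions of D converge strongly to  *)
(* the bounded operator L along refinement.  For F(t, A) = g(t) E(A), with g   *)
(* bounded Borel, this is the usual integral of g against E.                   *)
Definition is_oint (D : set C) (F : C -> set C -> H -> H) (L : H -> H) : Prop :=
  bounded_op L /\
  forall h, riemann_sum F h P @[P --> @refinement_filter D] --> L h.

(* E(A) is idempotent but not assumed self-adjoint: X need not be normal. *)
Record spectral_measure (X : H -> H) (E : set C -> H -> H) : Prop := {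
  sm_bounded : forall A, borel A -> bounded_op (E A);
  sm_commute : forall A h, borel A -> X (E A h) = E A (X h);
  sm_setI : forall A B h, borel A -> borel B -> E (A `&` B) h = E A (E B h);
  sm_total : forall h, E (spectrum X) h = h;
  sm_additive : forall A : nat -> set C, (forall n, borel (A n)) ->
    trivIset setT A -> forall h,
    \sum_(k < n) E (A k) h @[n --> \oo] --> E (\bigcup_k A k) h }.

Definition spectral_decomposition (X : H -> H) (E : set C -> H -> H) : Prop :=
  exists S N : H -> H,
    [/\ is_oint (spectrum X) (fun t A h => t *: E A h) S,
        is_oint (spectrum X) (fun t A h => sub_scalar X t (E A h)) N &
        forall h, X h = S h + N h].

(* (X - lambda)^l dE(lambda) = 0 whenever l >= m lambda, as an identity between *)
(* operator-valued measures.                                                   *)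
Definition nilpotent_order (X : H -> H) (E : set C -> H -> H) (m : C -> nat) :
    Prop :=
  forall (l : nat) (A : set C), borel A -> A `<=` spectrum X ->
    (forall t, A t -> (m t <= l)%N) ->
    is_oint A (fun t B h => iter l (sub_scalar X t) (E B h)) (fun=> 0).

Record spectral_op := SpectralOp {
  sop :> H -> H;
  smeas : set C -> H -> H;
  nilord : C -> nat;
  sop_bounded : bounded_op sop;
  smeasP : spectral_measure sop smeas;
  sop_decomposition : spectral_decomposition sop smeas;
  nilordP : nilpotent_order sop smeas nilord }.

Section MultiIndex.
Variable N : nat.
Implicit Types (b : ('I_N -> C) -> C) (x : 'I_N -> C) (q : 'I_N -> nat).

Definition pderiv (i : 'I_N) b : ('I_N -> C) -> C :=
  fun x => (fun t : C => b [eta x with i |-> t] : C^o)^`() (x i).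

(* d_0^{q 0} (d_1^{q 1} (... b)) *)
Definition mpderiv q b : ('I_N -> C) -> C :=
  foldr (fun i g => iter (q i) (pderiv i) g) b (enum 'I_N).

(* All the partial derivatives of b of order at most q exist near x. *)
Definition diff_upto q b x : Prop :=
  exists2 e : R, 0 < e &
  forall y : 'I_N -> C, (forall i, `|y i - x i| < e%:C) ->
  forall r : 'I_N -> nat, (forall i, (r i <= q i)%N) ->
  forall i, (r i < q i)%N ->
  derivable (fun t : C^o => mpderiv r b [eta y with i |-> t] : C^o) (y i) 1.

End MultiIndex.

(* A pair (K, (q_k)_{k in K}) with 1 <= q_k <= m_{lambda_k} - 1 is encoded as  *)
(* the multi-index q extended by q_p = 0 for p outside K; thus K is the        *)
(* support of q, and the admissible q_p are those with q_p < maxn 1 m.         *)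
Definition nrange (X : spectral_op) (t : C) : nat := maxn 1 (nilord X t).

Definition ext_op n (Y : 'I_n -> H -> H) (p : nat) : H -> H :=
  if insub p is Some j then Y j else id.

Section GMOI.
Variables (n : nat) (X : 'I_n.+1 -> spectral_op) (Y : 'I_n -> H -> H).
Variable b : ('I_n.+1 -> C) -> C.

Definition gmoi_coef (x : 'I_n.+1 -> C) (q : 'I_n.+1 -> nat) : C :=
  mpderiv q b x / (\prod_p (q p)`!)%:R.

(* The k innermost integrals, those over lambda_p with p >= n.+1 - k, for      *)
(* fixed values x, q of the outer variables and indices (the entries of x and  *)
(* q at the inner positions are irrelevant).  The sum over K and q is          *)
(* distributed over the iterated integral: the one over lambda_p carries       *)
(*   sum_{q_p} (X_p - lambda_p)^{q_p} dE_p(lambda_p) Y_p [inner integral],     *)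
(* and the coefficient is left for the innermost level.                        *)
Fixpoint is_gmoi_tail (k : nat) (x : 'I_n.+1 -> C) (q : 'I_n.+1 -> nat)
    (L : H -> H) {struct k} : Prop :=
  if k is k'.+1 then
    let p : 'I_n.+1 := inord (n - k') in
    exists G : C -> nat -> H -> H,
      (forall t r, spectrum (X p) t -> (r < nrange (X p) t)%N ->
         is_gmoi_tail k' [eta x with p |-> t] [eta q with p |-> r] (G t r)) /\
      is_oint (spectrum (X p))
        (fun t A h => \sum_(r < nrange (X p) t)
           iter r (sub_scalar (X p) t) (smeas (X p) A (ext_op Y p (G t r h))))
        L
  else L = (fun h => gmoi_coef x q *: h).

Definition sufficiently_differentiable : Prop :=
  forall (x : 'I_n.+1 -> C) (q : 'I_n.+1 -> nat),
    (forall p, spectrum (X p) (x p)) ->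
    (forall p, (q p < nrange (X p) (x p))%N) ->
    diff_upto q b x.

Definition is_gmoi (L : H -> H) : Prop :=
  sufficiently_differentiable /\
  is_gmoi_tail n.+1 (fun=> 0) (fun=> 0%N) L.

Definition gmoi_defined : Prop := exists L, is_gmoi L.

(* Meaningful when gmoi_defined holds. *)
Definition gmoi : H -> H := xget (fun=> 0) is_gmoi.

End GMOI.

(* The array X_1, [X], X_2, [X], ..., [X], X_{z+1} has period z.+2: positions  *)
(* i * z.+2 hold the separately listed X_i, positions i * z.+2 + j.+1 hold the *)
(* j-th entry of the i-th block (i, j counted from 0).                         *)
Section Blocks.
Variable z : nat.

Lemma block_size : (z * z.+2).+1 = (z.+1 ^ 2)%N.
Proof. by rewrite -[RHS]mulnn mulSnr !mulnS -addSn addnS addnC addnS. Qed.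

Definition block_params (X : 'I_z.+1 -> spectral_op) :
    'I_(z * z.+2).+1 -> spectral_op :=
  fun k => X (inord (if (k %% z.+2)%N is r.+1 then r else (k %/ z.+2)%N)).

(* I, [Y], I repeated: ext_op Y z is the closing identity of each group. *)
Definition block_args (Y : 'I_z -> H -> H) : 'I_(z * z.+2) -> H -> H :=
  fun k => if (k %% z.+2)%N is r.+1 then ext_op Y r else id.

Definition block_fun (f : ('I_z.+1 -> C) -> C)
    (b : 'I_z -> ('I_z.+1 -> C) -> C) : ('I_(z * z.+2).+1 -> C) -> C :=
  fun v => f (fun i => v (inord (i * z.+2)))
    * \prod_(i < z) b i (fun j => v (inord (i * z.+2 + j.+1))).

End Blocks.

End Operators.

(* Main.v *)
Require Import Defs.
From mathcomp Require Import all_boot all_order all_algebra complex.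
From mathcomp Require Import boolp classical_sets functions reals topology.
From mathcomp Require Import normedtype derive measurable_structure.

Set Implicit Arguments.
Unset Strict Implicit.
Unset Printing Implicit Defensive.

Import Order.TTheory GRing.Theory Num.Theory.
Import numFieldNormedType.Exports.

Local Open Scope complex_scope.
Local Open Scope ring_scope.
Local Open Scope classical_set_scope.

(* Fix the variables of [f] and of the earlier blocks.  Then the part of the    *)
(* iterated integral on the left that remains is a scalar times the             *)
(* corresponding part of the right-hand side: the integrals over the [i]-th     *)
(* block act as [T_(beta_i)] on everything that follows them, because no later  *)
(* variable occurs in [beta_i] and the later integral [W], which does not       *)
(* depend on the variables of the block, can be absorbed into the vector.  This *)
(* is proved from the innermost integral outwards; the scalar is the product of *)
(* the coefficients of the earlier [beta_j].  At the innermost level it uses    *)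
(* that a mixed partial derivative of a product of functions of disjoint sets   *)
(* of variables is the product of their mixed partial derivatives.              *)

Section Derivatives.
Variable R : realType.
Local Notation C := R[i].

(* The limit of a divergent difference quotient is the junk value [0], so no    *)
(* differentiability assumption is needed.                                      *)
Lemma derive1_scale (c : C) (g : C -> C) (a : C) :
  derive1 (fun t : C => c * g t : C^o) a = c * derive1 (fun t : C => g t : C^o) a.
Proof.
have [->|c0] := eqVneq c 0.
  rewrite mul0r (_ : (fun t => _) = cst (0 : C^o)) ?derive1_cst //.
  by apply/funext => t; rewrite mul0r.
have [dg|ndg] := pselect (derivable (fun t : C^o => g t : C^o) a 1).
  exact: (derive1Ml (f := fun t : C^o => g t : C^o) c dg).
have ndcg : ~ derivable (fun t : C^o => c * g t : C^o) a 1.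
  move=> dcg; apply: ndg.
  have := @derivableZ _ _ _ _ c^-1 _ _ dcg.
  rewrite (_ : _ \*: _ = (fun t : C^o => g t : C^o)) //.
  by apply/funext => t; rewrite /= /GRing.scale/= mulKf.
by rewrite !derive1E /derive (dvgP ndg) (dvgP ndcg) mulr0.
Qed.

Section ProductFunction.
Variables (A : finType) (M N : nat) (iota : A -> 'I_M -> 'I_N).
Hypothesis iota_inj : forall a a' i i', iota a i = iota a' i' -> a = a' /\ i = i'.
Hypothesis iota_surj : forall p, exists a i, p = iota a i.
Hypothesis iota_mono : forall a (i i' : 'I_M), (i < i')%N -> (iota a i < iota a i')%N.

(** The maps [iota a] distribute the variables among the factors [g a]. They are taken increasing
    because [mpderiv] differentiates in the order of the variables, and derivatives are not assumed
    to commute. *)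
Definition prodfun (g : A -> ('I_M -> C) -> C) : ('I_N -> C) -> C :=
  fun v => \prod_a g a (v \o iota a).

Lemma comp_upd_eq (T : Type) (v : 'I_N -> T) a i t :
  [eta v with iota a i |-> t] \o iota a = [eta v \o iota a with i |-> t].
Proof.
apply/funext => j /=; congr (if _ then _ else _).
by apply/eqP/eqP => [/iota_inj[]|->].
Qed.

Lemma comp_upd_neq (T : Type) (v : 'I_N -> T) a a' i t : a' != a ->
  [eta v with iota a i |-> t] \o iota a' = v \o iota a'.
Proof.
move=> /eqP aa'; apply/funext => j /=.
by case: eqP => // /iota_inj[].
Qed.

Lemma prodfun_upd g v a i t :
  prodfun g [eta v with iota a i |-> t] =
  (\prod_(a' | a' != a) g a' (v \o iota a')) * g a [eta v \o iota a with i |-> t].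
Proof.
rewrite /prodfun (bigD1 a)//= mulrC comp_upd_eq; congr (_ * _).
by apply: eq_bigr => a' aa'; rewrite comp_upd_neq.
Qed.

(** Only [g a] depends on the variable [iota a i]. The other factors form a constant, which
    [derive1_scale] takes out even where [g a] is not differentiable. *)
Lemma pderiv_prodfun g a i :
  pderiv (iota a i) (prodfun g) = prodfun [eta g with a |-> pderiv i (g a)].
Proof.
apply/funext => v; rewrite /pderiv.
under [X in derive1 X]funext do rewrite prodfun_upd.
rewrite derive1_scale [RHS](bigD1 a)//= eqxx mulrC; congr (_ * _).
by apply: eq_bigr => a' /negPf /= ->.
Qed.

Lemma iter_pderiv_prodfun g a i r :
  iter r (pderiv (iota a i)) (prodfun g) =
  prodfun [eta g with a |-> iter r (pderiv i) (g a)].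
Proof.
elim: r => [|r IH] /=; last first.
  rewrite IH pderiv_prodfun; congr prodfun; apply/funext => a' /=.
  by rewrite eqxx; case: (a' == a).
by congr prodfun; apply/funext => a' /=; case: eqP => // ->.
Qed.

Let dec a p := [pick i | iota a i == p].

Let decK a : ocancel (dec a) (iota a).
Proof. by move=> p; rewrite /dec; case: pickP => //= i /eqP. Qed.

Let dec_iota a i : dec a (iota a i) = Some i.
Proof.
rewrite /dec; case: pickP => [j /eqP/iota_inj[_ ->//]|/(_ i)].
by rewrite eqxx.
Qed.

Let dec_neq a a' i : a' != a -> dec a' (iota a i) = None.
Proof.
move=> /eqP aa'; rewrite /dec; case: pickP => // j /eqP/iota_inj[].
by move/aa'.
Qed.

(** Each derivative acts on a single factor, so [g a] receives those in the variables of [s] that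
    [dec a] decodes, in their original order. *)
Lemma foldr_pderiv_prodfun g (q : 'I_N -> nat) s :
  foldr (fun p h => iter (q p) (pderiv p) h) (prodfun g) s =
  prodfun (fun a => foldr (fun i h => iter (q (iota a i)) (pderiv i) h) (g a)
                          (pmap (dec a) s)).
Proof.
elim: s => //= p s ->; have [a [i ->]] := iota_surj p.
rewrite iter_pderiv_prodfun; congr prodfun; apply/funext => a' /=.
have [->|aa'] := eqVneq a' a; first by rewrite dec_iota.
by rewrite dec_neq.
Qed.

(** After applying [iota a], both lists are strictly increasing and have the same elements. *)
Lemma pmap_dec_enum a : pmap (dec a) (enum 'I_N) = enum 'I_M.
Proof.
have iota_a_inj : injective (iota a) by move=> i j /iota_inj[].
apply: (inj_map iota_a_inj); rewrite (pmap_filter (@decK a)).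
have sorted_enum m : sorted (relpre val ltn) (enum 'I_m).
  by rewrite -sorted_map val_enum_ord iota_ltn_sorted.
have tr m : transitive (relpre (val : 'I_m -> nat) ltn).
  by move=> j i k; apply: ltn_trans.
apply: (irr_sorted_eq (tr N)) => [p||| p].
- by rewrite /= ltnn.
- exact: (sorted_filter (tr N) _ (sorted_enum N)).
- rewrite sorted_map; apply: sub_sorted (sorted_enum M) => i j.
  exact: iota_mono.
- rewrite mem_filter mem_enum andbT; apply/idP/mapP.
    by case E: (dec a p) (decK a p) => [i|]//= <- _; exists i; rewrite ?mem_enum.
  by move=> [i _ ->]; rewrite dec_iota.
Qed.

Lemma mpderiv_prodfun g q :
  mpderiv q (prodfun g) = prodfun (fun a => mpderiv (q \o iota a) (g a)).
Proof.
rewrite /mpderiv foldr_pderiv_prodfun; congr prodfun; apply/funext => a.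
by rewrite pmap_dec_enum.
Qed.

Lemma diff_upto_prodfun g q x :
  (forall a, diff_upto (q \o iota a) (g a) (x \o iota a)) ->
  diff_upto q (prodfun g) x.
Proof.
move=> gd; have [e egd] := choice (fun a =>
  let: ex_intro2 e e0 h := gd a in ex_intro _ e (conj e0 h)).
(* The start value [1] is arbitrary; it keeps the radius positive even when there is no factor. *)
exists (\big[Num.min/1]_a e a).
  by apply: lt_bigmin => // a _; have [] := egd a.
move=> y xy r rq p rqp; have [a [i pE]] := iota_surj p.
have [_ /(_ (y \o iota a))] := egd a; move/(_ _ (r \o iota a) _ i).
rewrite mpderiv_prodfun pE.
under [X in _ -> derivable X _ _]funext do rewrite prodfun_upd.
move=> gda; apply: (@derivableZ _ _ _ (fun t : C^o => _ : C^o)).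
apply: gda => [j|j|]; last 2 first.
- exact: rq.
- by rewrite /= -pE.
- by apply: lt_le_trans (xy _) _; rewrite lecR bigmin_le.
Qed.

Lemma mpderiv_div_fact_prodfun g (q : 'I_N -> nat) x :
  mpderiv q (prodfun g) x / (\prod_p (q p)`!)%:R =
  \prod_a (mpderiv (q \o iota a) (g a) (x \o iota a) /
           (\prod_i (q (iota a i))`!)%:R).
Proof.
rewrite big_split mpderiv_prodfun; congr (_ * _).
rewrite /= prodfV; congr (_^-1); rewrite -natr_prod; congr (_%:R).
rewrite (reindex (fun ai : A * 'I_M => iota ai.1 ai.2))/=.
  by rewrite -(pair_bigA _ (fun a i => (q (iota a i))`!)).
have surj p : exists ai : A * 'I_M, iota ai.1 ai.2 = p.
  by have [a [i ->]] := iota_surj p; exists (a, i).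
have [inv invP] := choice surj.
apply: onW_bij; exists inv => [[a i]|p] //.
by case: (iota_inj (invP (iota a i))); case: (inv _) => a' i' /= -> ->.
Qed.

End ProductFunction.
End Derivatives.

(** * Uniqueness and transformation of operator integrals *)

Section Integral.
Variables (R : realType) (H : completeNormedModType R[i]).
Local Notation C := R[i].
Implicit Types (D : set C) (F : C -> set C -> H -> H) (L T : H -> H).

Lemma borelI (A B : set C) : borel A -> borel B -> borel (A `&` B).
Proof.
move=> bA bB; exact: (measurableI (A : set (g_sigma_algebraType
  ([set U : set C^o | open U] : set (set C^o)))) B bA bB).
Qed.

(** Intersecting the cells pairwise makes refinement directed, which turns [refinement_filter] into
    a filter. *)
Lemma common_refinement D (P Q : tagged_partition D) :
  exists S : tagged_partition D, refines S P /\ refines S Q.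
Proof.
pose cell (ij : 'I_(tp_size P) * 'I_(tp_size Q)) :=
  tp_cell ij.1 `&` tp_cell ij.2.
(* Empty intersections are dropped, since every cell must contain its tag. *)
pose K := [set ij | `[< cell ij !=set0 >] ]%SET.
have tagK (k : 'I_#|K|) : exists t, cell (enum_val k) t.
  by have := enum_valP k; rewrite inE => /asboolP.
have [tag tagP] := choice tagK.
unshelve eexists (@TaggedPartition R D #|K| (fun k => cell (enum_val k)) tag
  _ _ _ tagP).
- by move=> k; apply: borelI; apply: tp_borel.
- move=> k l _ _ [t [[P1 Q1] [P2 Q2]]]; apply: enum_val_inj.
  move: P1 Q1 P2 Q2; case: (enum_val k) (enum_val l) => i j [i' j'] /= *.
  by congr pair; apply: (tp_disjoint (t := _)) => //; exists t.
- apply/seteqP; split => [t [k _ [Pt _]]|t Dt].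
    by rewrite -(tp_cover P); exists (enum_val k).1.
  have := Dt; rewrite -{1}(tp_cover P) => -[i _ Pit].
  have := Dt; rewrite -{1}(tp_cover Q) => -[j _ Qjt].
  have ijK : (i, j) \in K by rewrite inE; apply/asboolP; exists t.
  by exists (enum_rank_in ijK (i, j)) => //; rewrite enum_rankK_in.
split=> k; first by exists (enum_val k).1 => t [].
by exists (enum_val k).2 => t [].
Qed.

Lemma refinement_filter_proper D (P : tagged_partition D) :
  ProperFilter (@refinement_filter R D).
Proof.
apply: filter_from_proper => [|Q _]; last by exists Q => i; exists i.
apply: filter_from_filter => [|Q1 Q2 _ _]; first by exists P.
have [S [SQ1 SQ2]] := common_refinement Q1 Q2; exists S => // S' S'S.
by split=> i; have [j Sj] := S'S i;
  [have [k Qk] := SQ1 j|have [k Qk] := SQ2 j]; exists k; apply: subset_trans Qk.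
Qed.

(* If [D] is not Borel, it has no tagged partition and no limit exists. *)
Lemma is_oint_proper D F L : is_oint D F L -> ProperFilter (@refinement_filter R D).
Proof.
move=> [_ /(_ 0) FL]; have [P _ _] := FL _ filterT.
exact: refinement_filter_proper P.
Qed.

Lemma eq_riemann_sum D F F' h h' (c : C) (P : tagged_partition D) :
  (forall t A, D t -> borel A -> F' t A h' = c *: F t A h) ->
  riemann_sum F' h' P = c *: riemann_sum F h P.
Proof.
move=> FF'; rewrite /riemann_sum scaler_sumr; apply: eq_bigr => i _.
apply: FF'; last exact: tp_borel.
have : (\bigcup_j tp_cell (t := P) j) (tp_tag i) by exists i => //; apply: tp_tagP.
by rewrite tp_cover.
Qed.

(** Tags lie in [D], so the two integrands have the same Riemann sums, and limits in [H] along a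
    proper filter are unique. *)
Lemma is_oint_unique D F F' L L' : is_oint D F L -> is_oint D F' L' ->
  (forall t A h, D t -> F t A h = F' t A h) -> L = L'.
Proof.
move=> FL [_ FL'] FF'; apply/funext => h.
have FF := is_oint_proper FL; case: FL => _ FL.
apply: (cvg_unique (@norm_hausdorff _ H)) (FL h) _.
rewrite (_ : riemann_sum F h = riemann_sum F' h); first exact: FL'.
apply/funext => P; rewrite -[RHS]scale1r; apply: eq_riemann_sum => t A Dt _.
by rewrite scale1r FF'.
Qed.

Lemma bounded_op_scale (c : C) T : bounded_op T -> bounded_op (fun h => c *: T h).
Proof.
move=> [linT cT]; split=> [a u v|h].
  by rewrite linT scalerDr !scalerA mulrC.
exact: (cvgZl_tmp (cT h)).
Qed.

Lemma bounded_op_comp T T' : bounded_op T -> bounded_op T' -> bounded_op (T \o T').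
Proof.
move=> [linT cT] [linT' cT']; split=> [a u v|h] /=; first by rewrite linT' linT.
exact: continuous_comp (cT' h) (cT _).
Qed.

Lemma bounded_op_id : bounded_op (@id H).
Proof. by split=> // h; apply: cvg_id. Qed.

Lemma bounded_opZ T (c : C) h : bounded_op T -> T (c *: h) = c *: T h.
Proof.
move=> [linT _]; have T0 : T 0 = 0.
  by have := linT 1 0 0; rewrite !scale1r addr0 -[LHS]addr0 => /addrI.
by have := linT c h 0; rewrite !addr0 T0 addr0.
Qed.

(** This takes a scalar out of an integral and absorbs an operator [W], constant in the integration
    variable, into the vector; it holds already for each Riemann sum. *)
Lemma is_oint_scale_comp D F F' L (c : C) (W : H -> H) : bounded_op W ->
  is_oint D F L ->
  (forall t A h, D t -> borel A -> F' t A h = c *: F t A (W h)) ->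
  is_oint D F' (fun h => c *: L (W h)).
Proof.
move=> bW FL FF'; have FF := is_oint_proper FL; case: FL => bL FL.
split=> [|h]; first exact: bounded_op_scale (bounded_op_comp bL bW).
rewrite (_ : riemann_sum F' h = c \*: riemann_sum F (W h)).
  exact: cvgZl_tmp (FL (W h)).
by apply/funext => P; apply: eq_riemann_sum => t A Dt /FF'-/(_ _ _ Dt).
Qed.

Lemma iter_sub_scalarZ T (t : C) r (c : C) h : bounded_op T ->
  iter r (sub_scalar T t) (c *: h) = c *: iter r (sub_scalar T t) h.
Proof.
move=> bT; elim: r => //= r ->.
by rewrite /sub_scalar bounded_opZ// scalerBr !scalerA mulrC.
Qed.

End Integral.

(** * Dependence on the outer variables and uniqueness of the iterated integral *)

Section GMOITail.
Variables (R : realType) (H : completeNormedModType R[i]).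
Local Notation C := R[i].
Variables (n : nat) (X : 'I_n.+1 -> spectral_op H) (Y : 'I_n -> H -> H).
Variable b : ('I_n.+1 -> C) -> C.

Lemma is_gmoi_tail_bounded k x q L : is_gmoi_tail X Y b k x q L -> bounded_op L.
Proof.
case: k => /= [->|k [G [_ []//]]].
exact: bounded_op_scale (@bounded_op_id R H).
Qed.

(** Each integral overwrites its own entry of [x] and [q], so only the entries of the outer
    variables matter; for a full GMOI there are none. *)
Lemma is_gmoi_tail_ext k x q x' q' L :
  (forall p : 'I_n.+1, (p < n.+1 - k)%N -> x p = x' p /\ q p = q' p) ->
  is_gmoi_tail X Y b k x q L -> is_gmoi_tail X Y b k x' q' L.
Proof.
elim: k x q x' q' L => [|k IH] x q x' q' L xx' /=.
  have xqE p := xx' p (ltn_ord p).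
  have -> : x = x' by apply/funext => p; case: (xqE p).
  by have -> : q = q' by apply/funext => p; case: (xqE p).
move=> [G [GP GL]]; exists G; split=> // t r Xt rt.
apply: IH (GP t r Xt rt) => p pk /=; case: eqP => // /eqP pn.
apply: xx'; move: pn; rewrite -val_eqE /= inordK ?ltnS ?leq_subr// => pn.
rewrite subSS ltn_neqAle pn -ltnS; apply: leq_trans pk _.
by rewrite leq_subLR addnS ltnS -leq_subLR.
Qed.

Lemma is_gmoi_tail_unique k x q L L' :
  is_gmoi_tail X Y b k x q L -> is_gmoi_tail X Y b k x q L' -> L = L'.
Proof.
elim: k x q L L' => [|k IH] x q L L' /= => [-> -> //|].
move=> [G [GP GL]] [G' [GP' GL']]; apply: is_oint_unique GL GL' _ => t A h Xt.
by apply: eq_bigr => r _; rewrite (IH _ _ _ _ (GP t r Xt _) (GP' t r Xt _)).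
Qed.

Lemma is_gmoi_unique L L' : is_gmoi X Y b L -> is_gmoi X Y b L' -> L = L'.
Proof. by move=> [_ L1] [_ L2]; apply: is_gmoi_tail_unique L1 L2. Qed.

Lemma gmoiP : gmoi_defined X Y b -> is_gmoi X Y b (gmoi X Y b).
Proof. by move=> [L LP]; apply: xgetPex; exists L. Qed.

End GMOITail.

(** * Positions of the variables in the block array *)

Section BlockPositions.
Variable z : nat.

(* [None] indexes the variables of [f], [Some i] those of the [i]-th block. *)
Definition block_pos (a : option 'I_z) (j : 'I_z.+1) : 'I_(z * z.+2).+1 :=
  inord (if a is Some i then i * z.+2 + j.+1 else j * z.+2).

Lemma val_block_pos a j :
  block_pos a j = (if a is Some i then i * z.+2 + j.+1 else j * z.+2)%N :> nat.
Proof.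
rewrite inordK // ltnS; case: a => [i|]; last by rewrite leq_mul2r -ltnS ltn_ord orbT.
apply: leq_trans (_ : i.+1 * z.+2 <= _)%N; last by rewrite leq_mul2r ltn_ord orbT.
by rewrite mulSnr leq_add2l ltnW// ltnS ltn_ord.
Qed.

Lemma block_pos_div_mod a j :
  (block_pos a j %/ z.+2 = (if a is Some i then i : nat else j))%N /\
  (block_pos a j %% z.+2 = if a is Some _ then j.+1 else 0)%N.
Proof.
rewrite val_block_pos; case: a => [i|]; last by rewrite mulnK// modnMl.
have jz : (j.+1 < z.+2)%N by rewrite ltnS ltn_ord.
by rewrite divnMDl// divn_small// addn0 modnMDl modn_small.
Qed.

Lemma block_pos_inj a a' j j' : block_pos a j = block_pos a' j' -> a = a' /\ j = j'.
Proof.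
move=> e; have [D M] := block_pos_div_mod a j.
have [] := block_pos_div_mod a' j'; rewrite -e D M.
case: a a' {e D M} => [i|] [i'|]//.
  by move=> /val_inj -> [] /val_inj ->.
by move=> /val_inj ->.
Qed.

Lemma block_pos_surj p : exists a j, p = block_pos a j.
Proof.
have pz : (p <= z * z.+2)%N by rewrite -ltnS.
case M : (p %% z.+2)%N => [|r].
  exists None, (inord (p %/ z.+2)); apply: val_inj; rewrite /= val_block_pos.
  rewrite inordK; first by rewrite {1}(divn_eq p z.+2) M addn0.
  by rewrite ltnS (leq_trans (leq_div2r z.+2 pz))// mulnK.
have rz : (r < z.+1)%N by rewrite -ltnS -M ltn_pmod.
have iz : (p %/ z.+2 < z)%N.
  rewrite ltn_divLR// ltn_neqAle pz andbT; apply/eqP => pE.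
  by move: M; rewrite pE modnMl.
exists (Some (Ordinal iz)), (Ordinal rz); apply: val_inj.
by rewrite /= val_block_pos /= {1}(divn_eq p z.+2) M.
Qed.

Lemma block_pos_mono a (j j' : 'I_z.+1) :
  (j < j')%N -> (block_pos a j < block_pos a j')%N.
Proof.
rewrite !val_block_pos; case: a => [i|] jj'; first by rewrite ltn_add2l.
by rewrite ltn_pmul2r.
Qed.

End BlockPositions.

(** * Evaluation of the block integral from the inside outwards *)

Section BlockGMOI.
Variables (R : realType) (H : completeNormedModType R[i]).
Local Notation C := R[i].
Variables (z : nat) (X : 'I_z.+1 -> spectral_op H) (Y : 'I_z -> H -> H).
Hypothesis bounded_Y : forall j, bounded_op (Y j).
Variables (f : ('I_z.+1 -> C) -> C) (beta : 'I_z -> ('I_z.+1 -> C) -> C).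
Hypothesis beta_defined : forall i, gmoi_defined X Y (beta i).

Local Notation pos := (@block_pos z).
Local Notation factor := (oapp beta f).
Local Notation Tbeta := (fun i => gmoi X Y (beta i)).
Local Notation f_tail := (is_gmoi_tail X Tbeta f).
Local Notation beta_tail i := (is_gmoi_tail X Y (beta i)).
Local Notation block_tail :=
  (is_gmoi_tail (block_params X) (block_args Y) (block_fun f beta)).

Let pos_inj := @block_pos_inj z.
Let pos_surj := @block_pos_surj z.
Let pos_mono := @block_pos_mono z.

Lemma block_funE : block_fun f beta = prodfun pos factor.
Proof.
apply/funext => v; rewrite /prodfun (bigD1 None)//= (reindex_omap Some id)=> [|[]]//=.
by congr GRing.mul; apply: eq_big => [i|i _]; rewrite ?eqxx.
Qed.

Lemma block_params_pos a j : block_params X (pos a j) = X j.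
Proof.
rewrite /block_params; have [-> ->] := block_pos_div_mod a j.
by case: a => [i|]; rewrite inord_val.
Qed.

Lemma block_args_pos a j :
  ext_op (block_args Y) (pos a j) = if a is Some _ then ext_op Y j else id.
Proof.
rewrite {1}/ext_op; case: insubP => [p _ pE|posN].
  rewrite /block_args pE; have [_ ->] := block_pos_div_mod a j.
  by case: a {pE}.
(* Only the last position has no argument after it. It belongs to [f], and [ext_op] is the identity
   there. *)
have posE : pos a j = (z * z.+2)%N :> nat.
  by apply/eqP; rewrite eqn_leq -ltnS ltn_ord leqNgt.
have [_] := block_pos_div_mod a j; rewrite posE modnMl.
by case: a {posN posE}.
Qed.

Lemma bounded_ext_op p : bounded_op (ext_op Y p).
Proof.
rewrite /ext_op; case: insubP => [j _ _|_]; first exact: bounded_Y.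
exact: bounded_op_id.
Qed.

Lemma block_fun_sufficiently_differentiable :
  sufficiently_differentiable X f ->
  sufficiently_differentiable (block_params X) (block_fun f beta).
Proof.
move=> df x q Xx qx; rewrite block_funE; apply: diff_upto_prodfun => //.
case=> [i|] /=; last first.
  by apply: df => j; rewrite -(block_params_pos None); [apply: Xx|apply: qx].
have [dbeta _] := gmoiP (beta_defined i).
by apply: dbeta => j; rewrite -(block_params_pos (Some i)); [apply: Xx|apply: qx].
Qed.
(* The factors [beta i'] whose variables precede those of the [i]-th block are   *)
(* constant in the integrals over the block and what follows it.               *)
Definition outer_coef (i : nat) (x : 'I_(z * z.+2).+1 -> C)
    (q : 'I_(z * z.+2).+1 -> nat) : C :=
  \prod_(i' < z | (i' < i)%N)
    gmoi_coef (beta i') (x \o pos (Some i')) (q \o pos (Some i')).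

Lemma outer_coefS (i : 'I_z) x q :
  outer_coef i.+1 x q =
  outer_coef i x q * gmoi_coef (beta i) (x \o pos (Some i)) (q \o pos (Some i)).
Proof.
rewrite /outer_coef (bigD1 i)//= mulrC; congr (_ * _); apply: eq_bigl => i'.
by rewrite ltnS [RHS]ltn_neqAle andbC.
Qed.

Lemma outer_coef_upd (i : nat) (a : option 'I_z) j x q t r :
  (if a is Some i' then i <= i' else true)%N ->
  outer_coef i [eta x with pos a j |-> t] [eta q with pos a j |-> r] =
  outer_coef i x q.
Proof.
move=> ai; apply: eq_bigr => i' i'i.
have aE : Some i' != a.
  case: a ai => //= i'' ii''; apply/eqP => -[E].
  by move: i'i; rewrite E ltnNge ii''.
by rewrite !(comp_upd_neq pos_inj).
Qed.

(** The mixed derivative and the product of factorials both split along the factors; at [z] the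
    outer coefficient contains every [beta i]. *)
Lemma gmoi_coef_block x q :
  gmoi_coef (block_fun f beta) x q =
  outer_coef z x q * gmoi_coef f (x \o pos None) (q \o pos None).
Proof.
rewrite /gmoi_coef block_funE (mpderiv_div_fact_prodfun pos_inj pos_surj pos_mono).
rewrite (bigD1 None)//= (reindex_omap Some id) => [|[]]//=.
rewrite mulrC; congr GRing.mul.
by apply: eq_big => [i|i _]; rewrite ?eqxx ?ltn_ord.
Qed.

(** One integral over a variable of [f]. The argument after it is [Tbeta i] on the right but the
    identity on the left, so on the left [Tbeta i] has to come from the inner integral. *)
Lemma block_tail_f_step i k x q W : (i <= z)%N -> (k + i * z.+2 = z * z.+2)%N ->
  (forall x' q' G, f_tail (z - i) (x' \o pos None) (q' \o pos None) G ->
    block_tail k x' q' (fun h => outer_coef i x' q' *: ext_op Tbeta i (G h))) ->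
  f_tail (z - i).+1 (x \o pos None) (q \o pos None) W ->
  block_tail k.+1 x q (fun h => outer_coef i x q *: W h).
Proof.
move=> iz kE inner /= [G [GP GW]].
have posE : inord (z * z.+2 - k) = pos None (inord i).
  have -> : (z * z.+2 - k = i * z.+2)%N by rewrite -kE addKn.
  by rewrite /block_pos inordK.
rewrite posE block_params_pos; rewrite subKn// in GP GW.
exists (fun t r h => outer_coef i x q *: ext_op Tbeta i (G t r h)); split.
  move=> t r Xt rt; rewrite -(outer_coef_upd (a := None) (inord i) x q t r)//.
  by apply: inner; rewrite !(comp_upd_eq pos_inj); apply: GP.
apply: (is_oint_scale_comp (@bounded_op_id R H) GW) => t A h Xt bA.
rewrite scaler_sumr; apply: eq_bigr => r _; rewrite block_args_pos inordK//.
rewrite (bounded_opZ _ _ (sm_bounded (smeasP _) bA)).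
exact: iter_sub_scalarZ (sop_bounded _).
Qed.

(** One integral over a variable of the [i]-th block. [W] depends only on variables of [f], so it is
    unchanged by the integration and, being bounded, passes into the vector. *)
Lemma block_tail_beta_step (i : 'I_z) (j : nat) k x q W L : (j <= z)%N ->
  (k + (i * z.+2 + j.+1) = z * z.+2)%N ->
  (forall x' q' G, f_tail (z - i) (x' \o pos None) (q' \o pos None) W ->
    beta_tail i (z - j) (x' \o pos (Some i)) (q' \o pos (Some i)) G ->
    block_tail k x' q' (fun h => outer_coef i x' q' *: G (W h))) ->
  f_tail (z - i) (x \o pos None) (q \o pos None) W ->
  beta_tail i (z - j).+1 (x \o pos (Some i)) (q \o pos (Some i)) L ->
  block_tail k.+1 x q (fun h => outer_coef i x q *: L (W h)).
Proof.
move=> jz kE inner fW /= [G [GP GL]].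
have posE : inord (z * z.+2 - k) = pos (Some i) (inord j).
  have -> : (z * z.+2 - k = i * z.+2 + j.+1)%N by rewrite -kE addKn.
  by rewrite /block_pos inordK.
rewrite posE block_params_pos; rewrite subKn// in GP GL.
exists (fun t r h => outer_coef i x q *: G t r (W h)); split.
  move=> t r Xt rt; rewrite -(outer_coef_upd (a := Some i) (inord j) x q t r)//.
  apply: inner; first by rewrite !(comp_upd_neq pos_inj).
  by rewrite !(comp_upd_eq pos_inj); apply: GP.
apply: (is_oint_scale_comp (is_gmoi_tail_bounded fW) GL) => t A h Xt bA.
rewrite scaler_sumr; apply: eq_bigr => r _; rewrite block_args_pos inordK//.
rewrite (bounded_opZ _ _ (bounded_ext_op _)).
rewrite (bounded_opZ _ _ (sm_bounded (smeasP _) bA)).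
exact: iter_sub_scalarZ (sop_bounded _).
Qed.

(** Induction on the number [d] of integrals left in the block. At [d = 0] the tail of [beta i] is
    its scalar coefficient, which joins the outer coefficient, and [next] takes over. *)
Lemma block_tail_beta (i : 'I_z) k :
  (k + i.+1 * z.+2 = z * z.+2)%N ->
  (forall x q W, f_tail (z - i) (x \o pos None) (q \o pos None) W ->
    block_tail k.+1 x q (fun h => outer_coef i.+1 x q *: W h)) ->
  forall d x q W L, (d <= z.+1)%N ->
  f_tail (z - i) (x \o pos None) (q \o pos None) W ->
  beta_tail i d (x \o pos (Some i)) (q \o pos (Some i)) L ->
  block_tail (k.+1 + d) x q (fun h => outer_coef i x q *: L (W h)).
Proof.
move=> kE next; elim=> [|d IH] x q W L dz fW.
  move=> ->; rewrite addn0.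
  rewrite (_ : (fun h => _) = fun h => outer_coef i.+1 x q *: W h); first exact: next.
  by apply/funext => h; rewrite outer_coefS -scalerA.
rewrite ltnS in dz; rewrite -{1}(subKn dz) addnS => bL.
apply: (block_tail_beta_step (leq_subr d z) _ _ fW bL).
  by rewrite -kE mulSnr addnACA addnS subnKC// addSn addSnnS addnA.
by move=> x' q' G; rewrite subKn//; apply: IH; rewrite leqW.
Qed.

(** Induction on the number [d] of blocks still to the right; each step adds a whole block and the
    separately listed parameter before it. *)
Lemma block_tail_f d k x q W : (d <= z)%N -> (k + (z - d) * z.+2 = z * z.+2)%N ->
  f_tail d.+1 (x \o pos None) (q \o pos None) W ->
  block_tail k.+1 x q (fun h => outer_coef (z - d) x q *: W h).
Proof.
elim: d k x q W => [|d IH] k x q W dz kE fW.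
  rewrite subn0 in kE *; have k0 : k = 0%N by apply: (@addIn (z * z.+2)).
  apply: (block_tail_f_step (leqnn z) kE); last by rewrite subnn.
  move=> x' q' G; rewrite subnn k0 /= => ->; apply/funext => h.
  (* No argument follows the last parameter, so [ext_op Tbeta z] is the identity. *)
  rewrite /ext_op; case: insubP => [j _ jE|_].
    by have := ltn_ord j; rewrite jE ltnn.
  by rewrite gmoi_coef_block scalerA.
have iz : (z - d.+1 < z)%N by rewrite ltn_subrL (leq_trans _ dz).
pose i := Ordinal iz; have iS : (i.+1 = z - d)%N by rewrite /= subnSK.
apply: (block_tail_f_step (ltnW iz) kE); last by rewrite subKn.
move=> x' q' G fG.
have -> : ext_op Tbeta (z - d.+1) = Tbeta i.
  by rewrite /ext_op insubT.
(* The [k] inner integrals are the [z.+1] of the block, one for the next separately listed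
   parameter, and [k'] after it. *)
have [k' kk'] : exists k', (k = k'.+1 + z.+1)%N.
  exists (d * z.+2)%N; apply/eqP; rewrite -(eqn_add2r ((z - d.+1) * z.+2)) kE.
  by rewrite addSnnS -mulSnr -mulnDl subnKC.
have k'E : (k' + (z - d) * z.+2 = z * z.+2)%N.
  by rewrite -iS -kE kk' mulSn addnA -[(k' + _)%N]addSnnS.
have zi : (z - i = d.+1)%N by rewrite /= subKn.
rewrite kk'; apply: (@block_tail_beta i) => //; first by rewrite iS.
- by move=> x'' q'' W'; rewrite zi iS; apply: IH => //; apply: ltnW.
(* All variables of the block are integrated here, so the tail is the full GMOI of [beta i],
   whatever the current [x'] and [q']. *)
- have [_] := gmoiP (beta_defined i); apply: is_gmoi_tail_ext => p.
  by rewrite subnn.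
Qed.

Lemma is_gmoi_block : gmoi_defined X Tbeta f ->
  is_gmoi (block_params X) (block_args Y) (block_fun f beta) (gmoi X Tbeta f).
Proof.
move=> /gmoiP[df fL]; split; first exact: block_fun_sufficiently_differentiable.
have := @block_tail_f z (z * z.+2) (fun=> 0) (fun=> 0%N) _ (leqnn z).
rewrite subnn addn0 => /(_ _ erefl fL).
rewrite (_ : (fun h => _ *: _) = gmoi X Tbeta f)//.
(* No block precedes the first one: the coefficient is an empty product. *)
apply/funext => h; rewrite /outer_coef big_pred0 ?scale1r// => i.
Qed.

End BlockGMOI.

Theorem proposition2 (R : realType) (H : completeNormedModType R[i])
  (dot : {dot H for Num.conj}) (hdot : hilbert_norm dot)
  (z : nat) (hz : (0 < z)%N)
  (X : 'I_z.+1 -> spectral_op H)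
  (Y : 'I_z -> H -> H) (hY : forall j, bounded_op (Y j))
  (f : ('I_z.+1 -> R[i]) -> R[i])
  (beta : 'I_z -> ('I_z.+1 -> R[i]) -> R[i])
  (hbeta : forall i, gmoi_defined X Y (beta i))
  (hf : gmoi_defined X (fun i => gmoi X Y (beta i)) f) :
  gmoi_defined (block_params X) (block_args Y) (block_fun f beta) /\
  gmoi (block_params X) (block_args Y) (block_fun f beta) =
    gmoi X (fun i => gmoi X Y (beta i)) f.
Proof.
have blockP := is_gmoi_block hY hbeta hf.
have bdef : gmoi_defined (block_params X) (block_args Y) (block_fun f beta).
  by eexists; apply: blockP.
(* [gmoi] is a chosen value, so uniqueness is what identifies it with the operator just found. *)
by split=> //; apply: is_gmoi_unique (gmoiP bdef) blockP.
Qed.
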